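(* Let $\mu_1\ge\mu_2>0$, $\mu_3>0$, and let $P_1,P_2,\mathcal P_1,\mathcal P_2\in\mathbb R$ with $\mu_2P_1=\mu_1P_2$. Let $(u_m)_{m\in\mathbb Z}$, $(w_m)_{m\in\mathbb Z}$ be real sequences satisfying the static equilibrium equations of the split two-chain strip, $$\mu_1(u_{m-1}-2u_m+u_{m+1})-\mu_3(u_m-w_m)=0,\qquad \mu_2(w_{m-1}-2w_m+w_{m+1})+\mu_3(u_m-w_m)=0\qquad(m\ge0),$$ $$u_{m-1}-2u_m+u_{m+1}=0,\qquad w_{m-1}-2w_m+w_{m+1}=0\qquad(m<0),$$ with tensile forces $\mu_1(u_{m}-u_{m-1})=P_1+\mathcal P_1$ and $\mu_2(w_{m}-w_{m-1})=P_2+\mathcal P_2$ for $m\le0$, and such that $u_m,w_m$ do not grow exponentially as $m\to+\infty$. Let $Q_m=w_m-u_m$ and $$\phi=\frac{\mu_3(\mu_1+\mu_2)}{2\mu_1\mu_2},\qquad \lambda_3=1+\phi+\sqrt{\phi^2+2\phi},\qquad \lambda_4=1/\lambda_3<1.$$ Then $Q_m=Q_0\lambda_4^m$ for all $m\ge0$, $$\lim_{m\to+\infty}(u_{m+1}-u_m)=\lim_{m\to+\infty}(w_{m+1}-w_m)=\frac{P_1}{\mu_1}+\frac{\mathcal P_1+\mathcal P_2}{\mu_1+\mu_2},$$ and $$\Theta:=\frac12\left(\frac{\mathcal P_1}{\mu_1}-\frac{\mathcal P_2}{\mu_2}\right)=\frac12(\lambda_3-1)Q_0.$$ In particular the critical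 external action, at which $Q_0$ equals the limiting bond strain $Q_*$, is $\Theta=\frac12(\lambda_3-1)Q_*$.
   Context: The strip consists of two mass-spring chains (unit spacing) with spring stiffnesses $\mu_1$ (displacements $u_m$) and $\mu_2$ (displacements $w_m$), with the masses of equal number $m$ connected by bonds of stiffness $\mu_3$ for $m\ge0$ and not connected for $m<0$. $P_1,P_2$ are initial tensile forces producing the same strain in both chains, and $\mathcal P_1,\mathcal P_2$ are additional forces applied to the separated chains far from the splitting point. $Q_*$ is the limiting strain of the connecting bonds. *)

(* Defs.v *)
From HB Require Import structures.
From mathcomp Require Import all_boot all_order all_algebra.
From mathcomp Require Import all_classical all_reals all_analysis.

Set Implicit Arguments.
Unset Strict Implicit.
Unset Printing Implicit Defensive.

Import Order.TTheory GRing.Theory Num.Theory.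
Import numFieldNormedType.Exports.

Local Open Scope classical_set_scope.
Local Open Scope ring_scope.

Definition second_difference (R : realType) (v : int -> R) (m : int) : R :=
  v (m - 1) - 2 * v m + v (m + 1).

(* Growth as m -> +oo only, since the values at negative m play no role.
   Only an eventual lower bound by a geometric sequence is asked for, so that
   the negation of this predicate is implied by subexponential growth, i.e. by
   v m = O(r ^ m) for every r > 1. *)
Definition grows_exponentially (R : realType) (v : int -> R) : Prop :=
  exists c r : R, [/\ 0 < c, 1 < r &
    \forall m \near \oo, c * r ^+ m <= `|v m%:Z| ].

(* Separation of the chains, i.e. the elongation of the bond at m when m >= 0. *)
Definition separation (R : realType) (u w : int -> R) (m : int) : R :=
  w m - u m.

Definition phi (R : realType) (mu1 mu2 mu3 : R) : R :=
  mu3 * (mu1 + mu2) / (2 * mu1 * mu2).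

(* lambda3 is the larger root of the characteristic equation
   x - 2 + x^-1 = 2 phi of the bonded part of the strip; lambda4 is the other. *)
Definition lambda3 (R : realType) (mu1 mu2 mu3 : R) : R :=
  1 + phi mu1 mu2 mu3
  + Num.sqrt (phi mu1 mu2 mu3 ^+ 2 + 2 * phi mu1 mu2 mu3).

Definition lambda4 (R : realType) (mu1 mu2 mu3 : R) : R :=
  1 / lambda3 mu1 mu2 mu3.

(* pp1 and pp2 are the additional forces on the separated chains. *)
Definition Theta (R : realType) (mu1 mu2 pp1 pp2 : R) : R :=
  1 / 2 * (pp1 / mu1 - pp2 / mu2).

(* Main.v *)
Require Import Defs.
From HB Require Import structures.
From mathcomp Require Import all_boot all_order all_algebra.
From mathcomp Require Import all_classical all_reals all_analysis.
From mathcomp Require Import ring lra.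

Set Implicit Arguments.
Unset Strict Implicit.
Unset Printing Implicit Defensive.

Import Order.TTheory GRing.Theory Num.Theory.
Import numFieldNormedType.Exports.

Local Open Scope classical_set_scope.
Local Open Scope ring_scope.

(* The weighted sum mu1 u + mu2 w is affine in m, and the separation Q solves a
   linear recurrence with characteristic roots lambda3 > 1 and lambda4 < 1.
   Since u is a combination of both, the coefficient of lambda3 ^ m in Q must
   vanish, or u would grow exponentially; hence Q m = Q 0 * lambda4 ^ m, and the
   equilibrium equation at m = 0 gives Q (-1) = lambda3 * Q 0.  The elongations
   of the two chains just before the bonded part then determine Q 0. *)

(** [x n.+1 - b * x n] is geometric with ratio [a], and by symmetry [x n.+1 - a * x n] is geometric
    with ratio [b]; their difference eliminates [x n.+1]. Keeping the factor [a - b] on the left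
    avoids division. *)
Lemma linear_recurrence2 (R : comRingType) (a b : R) (x : nat -> R) :
    (forall n, x n.+2 = (a + b) * x n.+1 - a * b * x n) ->
  forall n, (a - b) * x n =
    (x 1%N - b * x 0%N) * a ^+ n - (x 1%N - a * x 0%N) * b ^+ n.
Proof.
move=> hx n.
have geo c d : (forall k, x k.+2 = (c + d) * x k.+1 - c * d * x k) ->
    x n.+1 - d * x n = (x 1%N - d * x 0%N) * c ^+ n.
  move=> h; elim: n => [|k IH]; first by rewrite expr0 mulr1.
  by rewrite exprSr mulrA -IH h; ring.
rewrite -(geo a b hx) -(geo b a); first by ring.
by move=> k; rewrite hx; ring.
Qed.

Lemma affine_sequence (R : pzRingType) (x : nat -> R) :
    (forall n, x n.+2 - x n.+1 = x n.+1 - x n) ->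
  forall n, x n = x 0%N + (x 1%N - x 0%N) *+ n.
Proof.
move=> hx; have step n : x n.+1 - x n = x 1%N - x 0%N.
  by elim: n => // n IH; rewrite hx.
elim=> [|n IH]; first by rewrite mulr0n addr0.
by rewrite mulrSr addrA -IH -(step n) addrC subrK.
Qed.

Lemma bernoulli_ineq (R : realDomainType) (h : R) (n : nat) :
  0 <= h -> 1 + n%:R * h <= (1 + h) ^+ n.
Proof.
move=> h0; elim: n => [|n IH]; first by rewrite expr0 mul0r addr0.
rewrite exprS -natr1.
have n0 : 0 <= n%:R :> R by exact: ler0n.
by nra.
Qed.

Lemma cvg_natr_div_exprn (R : realType) (r : R) : 1 < r ->
  (fun n : nat => n%:R * r^-1 ^+ n) @ \oo --> (0 : R).
Proof.
move=> r1.
have r0 : 0 <= r by lra.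
(* Bernoulli on the square root s leaves one factor s^-n for the decay. *)
set s := Num.sqrt r.
have s1 : 1 < s by rewrite -sqrtr1 ltr_sqrt //; lra.
have s0 : 0 < s by lra.
have rE : r = s * s by rewrite -expr2 sqr_sqrtr.
have bnd n : 0 <= n%:R * r^-1 ^+ n <= (s - 1)^-1 * s^-1 ^+ n.
  have sn : 0 < s ^+ n by exact: exprn_gt0.
  rewrite mulr_ge0 ?exprn_ge0 ?invr_ge0 //=.
  rewrite rE invfM exprMn mulrA ler_wpM2r ?exprn_ge0 ?invr_ge0 ?(ltW s0) //.
  rewrite exprVn ler_pdivrMr // ler_pdivlMl ?subr_gt0 //.
  have s1ge0 : 0 <= s - 1 by lra.
  have := bernoulli_ineq n s1ge0; rewrite [1 + (s - 1)]addrC subrK.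
  by lra.
apply: (@squeeze_cvgr _ _ _ _ (fun=> 0) (fun n => (s - 1)^-1 * s^-1 ^+ n)).
- by near=> n; exact: bnd.
- exact: cvg_cst.
- apply: cvg_geometric.
  by rewrite ger0_norm ?invr_ge0 ?ltW // invf_lt1.
Unshelve. all: by end_near.
Qed.

(** After division by [r ^+ n] every term except [c] tends to 0, so eventually the absolute value of
    the quotient is at least half of [|c|]. *)
Lemma grows_exponentially_lincomb (R : realType) (v : int -> R) (a b c d r s : R) :
    1 < r -> `|s| < 1 -> c != 0 ->
    (forall n : nat, v n%:Z = a + b * n%:R + c * r ^+ n + d * s ^+ n) ->
  grows_exponentially v.
Proof.
move=> r1 s1 c0 hv.
have r0 : 0 < r by lra.
have ri1 : `|r^-1| < 1 by rewrite ger0_norm ?invr_ge0 ?ltW // invf_lt1.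
exists (`|c| / 2), r; split => //; first by rewrite divr_gt0 ?normr_gt0.
have cv : (fun n : nat => v n%:Z * r^-1 ^+ n) @ \oo --> c.
  rewrite (_ : (fun n => _) = (fun n : nat => a * r^-1 ^+ n +
     b * (n%:R * r^-1 ^+ n) + c + d * (s * r^-1) ^+ n)); last first.
    apply/funext => n; rewrite hv exprMn.
    have : r ^+ n * r^-1 ^+ n = 1 by rewrite -exprMn divff ?gt_eqF // expr1n.
    by move: (r ^+ n) (r^-1 ^+ n) => x y xy; ring: xy.
  rewrite -[X in _ --> X]add0r -[X in _ --> X]addr0.
  apply: cvgD; last first.
    apply: cvg_geometric; rewrite normrM.
    have := normr_ge0 s; have := normr_ge0 r^-1; nra.
  apply: cvgD; last exact: cvg_cst.
  rewrite -[X in _ --> X]addr0; apply: cvgD; first exact: cvg_geometric.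
  by rewrite -[X in _ --> X](mulr0 b); apply: cvgMl_tmp; exact: cvg_natr_div_exprn.
have half : `|c| / 2 < `|c| by have := normr_gt0 c; rewrite c0; lra.
apply: filterS (cvgr_norm_ge c cv _ half) => n.
rewrite normrM normrX [`|r^-1|]ger0_norm ?invr_ge0 ?(ltW r0) // exprVn.
by rewrite ler_pdivlMr // exprn_gt0.
Qed.

Lemma intSr (n : nat) : n%:Z + 1 = n.+1%:Z.
Proof. by rewrite -addn1 PoszD. Qed.

Lemma second_differenceS (R : realType) (v : int -> R) (n : nat) :
  second_difference v n.+1%:Z = v n%:Z - 2 * v n.+1%:Z + v n.+2%:Z.
Proof. by rewrite /second_difference intSr -(intSr n) addrK. Qed.

Lemma phi_gt0 (R : realType) (mu1 mu2 mu3 : R) :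
  0 < mu1 -> 0 < mu2 -> 0 < mu3 -> 0 < phi mu1 mu2 mu3.
Proof. by move=> *; rewrite divr_gt0 // !mulr_gt0 // addr_gt0. Qed.

Lemma lambda3_gt1 (R : realType) (mu1 mu2 mu3 : R) :
  0 < phi mu1 mu2 mu3 -> 1 < lambda3 mu1 mu2 mu3.
Proof.
move=> p0; rewrite /lambda3.
have := sqrtr_ge0 (phi mu1 mu2 mu3 ^+ 2 + 2 * phi mu1 mu2 mu3).
by lra.
Qed.

(** With [s ^+ 2 = p ^+ 2 + 2 * p] one has [(1 + p + s) * (1 + p - s) = 1], so [lambda4] is the
    conjugate [1 + p - s]. *)
Lemma lambda3D4 (R : realType) (mu1 mu2 mu3 : R) : 0 < phi mu1 mu2 mu3 ->
  lambda3 mu1 mu2 mu3 + lambda4 mu1 mu2 mu3 = 2 + 2 * phi mu1 mu2 mu3.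
Proof.
move=> p0; have := lambda3_gt1 p0; rewrite /lambda4 /lambda3.
move: (phi _ _ _) p0 => p p0.
have p20 : 0 <= p ^+ 2 + 2 * p by nra.
move: (Num.sqrt _) (sqr_sqrtr p20) => s hs l1.
apply: (@mulIf _ (1 + p + s)); first by rewrite gt_eqF //; lra.
rewrite mulrDl divfK; last by rewrite gt_eqF //; lra.
by ring: hs.
Qed.

Theorem mainTheorem7 (R : realType) (mu1 mu2 mu3 P1 P2 pp1 pp2 : R)
    (u w : int -> R)
    (hmu12 : mu2 <= mu1) (hmu2 : 0 < mu2) (hmu3 : 0 < mu3)
    (hP : mu2 * P1 = mu1 * P2)
    (equ_bonded : forall m : int, 0 <= m ->
       mu1 * second_difference u m - mu3 * (u m - w m) = 0)
    (eqw_bonded : forall m : int, 0 <= m ->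
       mu2 * second_difference w m + mu3 * (u m - w m) = 0)
    (equ_split : forall m : int, m < 0 -> second_difference u m = 0)
    (eqw_split : forall m : int, m < 0 -> second_difference w m = 0)
    (force_u : forall m : int, m <= 0 -> mu1 * (u m - u (m - 1)) = P1 + pp1)
    (force_w : forall m : int, m <= 0 -> mu2 * (w m - w (m - 1)) = P2 + pp2)
    (hgrowth_u : ~ grows_exponentially u)
    (hgrowth_w : ~ grows_exponentially w) :
  let Q := separation u w in
  let l3 := lambda3 mu1 mu2 mu3 in
  let l4 := lambda4 mu1 mu2 mu3 in
  let strain := P1 / mu1 + (pp1 + pp2) / (mu1 + mu2) in
  let theta := Theta mu1 mu2 pp1 pp2 in
  [/\ l4 < 1 /\ (forall m : nat, Q m%:Z = Q 0 * l4 ^+ m),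
      (fun m : nat => u (m%:Z + 1) - u m%:Z) @ \oo --> strain,
      (fun m : nat => w (m%:Z + 1) - w m%:Z) @ \oo --> strain,
      theta = 1 / 2 * (l3 - 1) * Q 0 &
      forall Qstar : R, Q 0 = Qstar <-> theta = 1 / 2 * (l3 - 1) * Qstar].
Proof.
move=> Q l3 l4 strain theta.
have hmu1 : 0 < mu1 by lra.
have p0 := phi_gt0 hmu1 hmu2 hmu3.
have l31 : 1 < l3 := lambda3_gt1 p0.
have l3D4 : l3 + l4 = 2 + 2 * phi mu1 mu2 mu3 := lambda3D4 p0.
have phiE : mu1 * mu2 * (2 * phi mu1 mu2 mu3) = mu3 * (mu1 + mu2).
  by rewrite /phi; field; rewrite !gt_eqF.
have l34 : l3 * l4 = 1 by rewrite /l4 /lambda4 mulrCA divff ?mulr1 ?gt_eqF //; lra.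
have l40 : 0 < l4 by rewrite divr_gt0 //; rewrite -/l3; lra.
have l41 : l4 < 1 by nra.
have nl41 : `|l4| < 1 by rewrite ger0_norm // ltW.
(* [mu1] times the [w] equation minus [mu2] times the [u] equation involves [Q] alone. *)
have sepE m : 0 <= m -> second_difference Q m = (l3 + l4 - 2) * Q m.
  move=> m0; have := equ_bonded m m0; have := eqw_bonded m m0.
  rewrite l3D4 [2 + _]addrC addrK => /(congr1 ( *%R mu1)) e2 /(congr1 ( *%R mu2)) e1.
  apply: (@mulfI _ (mu1 * mu2)); first by rewrite mulf_neq0 ?gt_eqF.
  rewrite mulrA phiE.
  by move: e1 e2; rewrite /Q /separation /second_difference; lra.
(* The bond forces are opposite, so they cancel when the two equations are added. *)
have sumE m : 0 <= m ->
    second_difference (fun k => mu1 * u k + mu2 * w k) m = 0.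
  move=> m0; have := equ_bonded m m0; have := eqw_bonded m m0.
  by rewrite /second_difference; lra.
(* Only the equations at positive indices enter here; the one at 0 is kept to link [Q (-1)] to
   [Q 0]. *)
have Qrec (n : nat) : Q n.+2%:Z = (l3 + l4) * Q n.+1%:Z - l3 * l4 * Q n%:Z.
  by have := sepE n.+1 isT; rewrite second_differenceS l34; lra.
have Qsol := linear_recurrence2 Qrec.
have Srec (n : nat) : (mu1 * u n.+2%:Z + mu2 * w n.+2%:Z)
    - (mu1 * u n.+1%:Z + mu2 * w n.+1%:Z) =
    (mu1 * u n.+1%:Z + mu2 * w n.+1%:Z) - (mu1 * u n%:Z + mu2 * w n%:Z).
  by have := sumE n.+1 isT; rewrite second_differenceS; lra.
have Ssol := affine_sequence Srec.
set S0 := mu1 * u 0%:Z + mu2 * w 0%:Z in Ssol.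
set T := mu1 * u 1%:Z + mu2 * w 1%:Z - S0 in Ssol.
have l3B4 : l3 - l4 != 0 by rewrite gt_eqF //; lra.
have M0 : mu1 + mu2 != 0 by rewrite gt_eqF //; lra.
have uE (k : int) : u k = ((mu1 * u k + mu2 * w k) - mu2 * Q k) / (mu1 + mu2).
  by rewrite /Q /separation; field.
have wE (k : int) : w k = ((mu1 * u k + mu2 * w k) + mu1 * Q k) / (mu1 + mu2).
  by rewrite /Q /separation; field.
have Q1 : Q 1 = l4 * Q 0.
  apply/eqP/negP => /negP nQ; apply: hgrowth_u.
  (* The coefficients come from inserting [Ssol] and [Qsol] into [uE]; that of [l3 ^+ n] is a
     nonzero multiple of [Q 1 - l4 * Q 0]. *)
  apply: (@grows_exponentially_lincomb _ _ (S0 / (mu1 + mu2)) (T / (mu1 + mu2))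
    (- mu2 / (mu1 + mu2) * ((Q 1 - l4 * Q 0) / (l3 - l4)))
    (mu2 / (mu1 + mu2) * ((Q 1 - l3 * Q 0) / (l3 - l4))) l3 l4) => //.
    by rewrite !mulf_neq0 ?invr_eq0 ?oppr_eq0 // ?subr_eq0 // gt_eqF.
  move=> n; rewrite uE Ssol.
  have -> : Q n%:Z = (l3 - l4) * Q n%:Z / (l3 - l4) by rewrite mulrAC divff ?mul1r.
  by rewrite Qsol -mulr_natr; field; rewrite l3B4 M0.
have QE (m : nat) : Q m%:Z = Q 0 * l4 ^+ m.
  by apply: (mulfI l3B4); rewrite Qsol Q1; ring.
have eq0 := sepE 0 (lexx 0).
have eS0 := sumE 0 (lexx 0).
have fu := force_u 0 (lexx 0).
have fw := force_w 0 (lexx 0).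
rewrite /second_difference !(sub0r, add0r) in eq0 eS0 fu fw.
have Qm1 : Q (-1) = l3 * Q 0 by move: eq0; rewrite Q1; lra.
(* By [eS0] the increment of the weighted sum is the same on both sides of 0, hence equal to the
   total applied force. *)
have TE : T = P1 + pp1 + P2 + pp2 by rewrite /T /S0; lra.
have strainE : strain = T / (mu1 + mu2).
  (* Equal initial strains give [(P1 + P2) / (mu1 + mu2) = P1 / mu1]. *)
  have P2E : P2 = mu2 * P1 / mu1 by rewrite hP mulrC mulKf ?gt_eqF.
  by rewrite TE P2E /strain; field; rewrite M0 gt_eqF.
have thetaE : theta = 1 / 2 * (l3 - 1) * Q 0.
  (* [(l3 - 1) * Q 0 = Q (-1) - Q 0] is the difference of the two elongations just before the bonds;
     the equal initial strains then cancel in it. *)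
  have -> : 1 / 2 * (l3 - 1) * Q 0 = 1 / 2 * ((u 0 - u (-1)) - (w 0 - w (-1))).
    by move: Qm1; rewrite /Q /separation; lra.
  have -> : u 0 - u (-1) = (P1 + pp1) / mu1 by rewrite -fu mulrC mulKf ?gt_eqF.
  have -> : w 0 - w (-1) = (P2 + pp2) / mu2 by rewrite -fw mulrC mulKf ?gt_eqF.
  by rewrite /theta /Theta; field: hP; rewrite !gt_eqF.
(* In each chain the elongation differs from [strain] by a multiple of [Q m - Q m.+1], which is
   geometric of ratio [l4]. *)
have lim (v : int -> R) (c : R) :
    (forall m : nat, v (m%:Z + 1) - v m%:Z = strain + c * l4 ^+ m) ->
    (fun m : nat => v (m%:Z + 1) - v m%:Z) @ \oo --> strain.
  move=> hv; rewrite (funext hv) -[X in _ --> X]addr0.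
  by apply: cvgD; [exact: cvg_cst | exact: cvg_geometric].
split=> //.
- apply: (lim _ (mu2 * (1 - l4) * Q 0 / (mu1 + mu2))) => m.
  rewrite intSr uE (uE m) !Ssol (QE m.+1) (QE m) strainE mulrS exprS; field.
  exact: M0.
- apply: (lim _ (- mu1 * (1 - l4) * Q 0 / (mu1 + mu2))) => m.
  rewrite intSr wE (wE m) !Ssol (QE m.+1) (QE m) strainE mulrS exprS; field.
  exact: M0.
- move=> Qstar; split=> [<- // |]; rewrite thetaE.
  by apply: mulfI; rewrite mulf_neq0 // gt_eqF //; lra.
Qed.
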